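(* Let $L$ be the first-order language with equality and one binary relation symbol $R$, and let $L^{(d)}$ be the first-order language with equality and one binary relation symbol $S$ instead of $R$. Let $A_c$ be the $L$-sentence $$(\forall X)(\exists! Y)(\forall a)\bigl(a\,R\,X \leftrightarrow \neg(a\,R\,Y)\bigr),$$ and write $X^d$ for the unique $Y$ associated with $X$. Let $\Gamma$ be an $L$-theory that includes the axiom $A_c$, and let $\Phi$ be an $L$-sentence. For an $L$-formula $\Psi$, let $\Psi^{(d)}$ be the $L^{(d)}$-formula obtained from $\Psi$ by replacing every occurrence of $R$ by $S$, and let $\Gamma^{(d)}=\{\Psi^{(d)} : \Psi\in\Gamma\}$. Then: (1) $\Gamma\vdash_L \Phi$ if and only if $\Gamma^{(d)}\vdash_{L^{(d)}}\Phi^{(d)}$. (2) If $M$ is an $L$-model of $\Gamma$, let $M^{(d)}$ be the $L^{(d)}$-structure with the same underlying set as $M$ in which $S$ is interpreted by: for all $A,B\in M$, $A\,S^{M^{(d)}}B$ if and only if $A^d\,R^M\,B^d$, where $X^d$ denotes the complement of $X$ computed in $M$. Then the map $X\mapsto X^d$ is an isomorphism between $M$ and $M^{(d)}$ (with $R$ in $M$ corresponding to $S$ in $M^{(d)}$).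
   Context: $\vdash_L$ and $\vdash_{L^{(d)}}$ denote ordinary first-order provability (with equality) in the respective languages. All variables range over the whole domain of a structure. In a model $M$ of $A_c$, for each $X\in M$ the complement $X^d$ is the unique element of $M$ such that for all $a\in M$: $a\,R^M X$ if and only if not $a\,R^M X^d$. That a map $f:M\to M^{(d)}$ is an isomorphism (with $R$ corresponding to $S$) means that $f$ is a bijection and, for all $A,B\in M$, $A\,R^M B$ if and only if $f(A)\,S^{M^{(d)}}f(B)$. The relation symbol $S$ is thought of as the dual of $R$, defined by $A\,S\,B\leftrightarrow A^d\,R\,B^d$. *)

(* Defs.v *)
From Stdlib Require Import List ClassicalEpsilon.
From Stdlib Require Export FinFun.
Import ListNotations.

Set Implicit Arguments.
Unset Strict Implicit.

(** A language with equality is given by its type [B] of binary relation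
    symbols. There are no function or constant symbols, so every term is a
    variable, and variables are de Bruijn indices. *)

Inductive formula (B : Type) : Type :=
| Bot : formula B
| Eq : nat -> nat -> formula B
| Rel : B -> nat -> nat -> formula B
| Imp : formula B -> formula B -> formula B
| And : formula B -> formula B -> formula B
| Or : formula B -> formula B -> formula B
| All : formula B -> formula B
| Ex : formula B -> formula B.

Arguments Bot {B}.
Arguments Eq {B} _ _.

Definition Not B (p : formula B) : formula B := Imp p Bot.
Definition Iff B (p q : formula B) : formula B := And (Imp p q) (Imp q p).

Definition up (r : nat -> nat) (n : nat) : nat :=
  match n with 0 => 0 | S k => S (r k) end.

Fixpoint rename B (r : nat -> nat) (p : formula B) : formula B :=
  match p with
  | Bot => Bot
  | Eq x y => Eq (r x) (r y)
  | Rel s x y => Rel s (r x) (r y)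
  | Imp p q => Imp (rename r p) (rename r q)
  | And p q => And (rename r p) (rename r q)
  | Or p q => Or (rename r p) (rename r q)
  | All p => All (rename (up r) p)
  | Ex p => Ex (rename (up r) p)
  end.

Definition shift B (p : formula B) : formula B := rename S p.

(** [inst t p] substitutes the variable [t] for index 0 and lowers the other
    indices: the body of a quantifier instantiated at [t]. *)
Definition inst B (t : nat) (p : formula B) : formula B :=
  rename (fun n => match n with 0 => t | S k => k end) p.

(** [exists! Y, p Y] is [exists Y, p Y /\ forall Z, p Z -> Z = Y]. Below the
    second quantifier, Z is 0, Y is 1, and the parameters of [p] move up. *)
Definition Ex1 B (p : formula B) : formula B :=
  Ex (And p (All (Imp (rename (up S) p) (Eq 0 1)))).

Fixpoint free_in B (x : nat) (p : formula B) : Prop :=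
  match p with
  | Bot => False
  | Eq y z => x = y \/ x = z
  | Rel _ y z => x = y \/ x = z
  | Imp p q | And p q | Or p q => free_in x p \/ free_in x q
  | All p | Ex p => free_in (S x) p
  end.

Definition sentence B (p : formula B) : Prop := forall x, ~ free_in x p.

Definition theory B (T : formula B -> Prop) : Prop := forall p, T p -> sentence p.

(** Classical natural deduction with equality. *)
Inductive derives (B : Type) : list (formula B) -> formula B -> Prop :=
| d_hyp H p : In p H -> derives H p
| d_raa H p : derives (Not p :: H) Bot -> derives H p
| d_impI H p q : derives (p :: H) q -> derives H (Imp p q)
| d_impE H p q : derives H (Imp p q) -> derives H p -> derives H q
| d_andI H p q : derives H p -> derives H q -> derives H (And p q)
| d_andE1 H p q : derives H (And p q) -> derives H p
| d_andE2 H p q : derives H (And p q) -> derives H q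
| d_orI1 H p q : derives H p -> derives H (Or p q)
| d_orI2 H p q : derives H q -> derives H (Or p q)
| d_orE H p q c :
    derives H (Or p q) -> derives (p :: H) c -> derives (q :: H) c -> derives H c
| d_allI H p : derives (map (@shift B) H) p -> derives H (All p)
| d_allE H p t : derives H (All p) -> derives H (inst t p)
| d_exI H p t : derives H (inst t p) -> derives H (Ex p)
| d_exE H p c :
    derives H (Ex p) -> derives (p :: map (@shift B) H) (shift c) -> derives H c
| d_eqI H x : derives H (Eq x x)
| d_eqE H p x y : derives H (Eq x y) -> derives H (inst x p) -> derives H (inst y p).

Definition provable B (T : formula B -> Prop) (p : formula B) : Prop :=
  exists H : list (formula B), (forall q, In q H -> T q) /\ derives H p.

Record structure (B : Type) : Type := {
  carrier :> Type;
  carrier_inhabited : inhabited carrier;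
  interp : B -> carrier -> carrier -> Prop
}.

Definition scons T (a : T) (e : nat -> T) (n : nat) : T :=
  match n with 0 => a | S k => e k end.

Fixpoint sat B (M : structure B) (e : nat -> M) (p : formula B) : Prop :=
  match p with
  | Bot => False
  | Eq x y => e x = e y
  | Rel s x y => interp s (e x) (e y)
  | Imp p q => sat e p -> sat e q
  | And p q => sat e p /\ sat e q
  | Or p q => sat e p \/ sat e q
  | All p => forall a : M, sat (scons a e) p
  | Ex p => exists a : M, sat (scons a e) p
  end.

Definition holds B (M : structure B) (p : formula B) : Prop :=
  forall e : nat -> M, sat e p.

Definition model B (M : structure B) (T : formula B -> Prop) : Prop :=
  forall p, T p -> holds M p.

Definition isomorphism B C (s : B -> C) (M : structure B) (N : structure C)
    (f : M -> N) : Prop :=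
  Bijective f /\
  forall (r : B) (a b : M), interp r a b <-> interp (s r) (f a) (f b).

Inductive L : Type := sym_R.
Inductive Ld : Type := sym_S.

Definition R_to_S (r : L) : Ld := match r with sym_R => sym_S end.

Fixpoint map_symbols B C (s : B -> C) (p : formula B) : formula C :=
  match p with
  | Bot => Bot
  | Eq x y => Eq x y
  | Rel r x y => Rel (s r) x y
  | Imp p q => Imp (map_symbols s p) (map_symbols s q)
  | And p q => And (map_symbols s p) (map_symbols s q)
  | Or p q => Or (map_symbols s p) (map_symbols s q)
  | All p => All (map_symbols s p)
  | Ex p => Ex (map_symbols s p)
  end.

Definition dual_formula (p : formula L) : formula Ld := map_symbols R_to_S p.

Definition dual_theory (T : formula L -> Prop) : formula Ld -> Prop :=
  fun q => exists p, T p /\ q = dual_formula p.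

(** In the innermost scope, a is 0, Y is 1 and X is 2. *)
Definition A_c : formula L :=
  All (Ex1 (All (Iff (Rel sym_R 0 2) (Not (Rel sym_R 0 1))))).

Definition is_complement (M : structure L) (X Y : M) : Prop :=
  forall a : M, interp sym_R a X <-> ~ interp sym_R a Y.

(** Meaningful only when [M] satisfies [A_c], see [complementP]. *)
Definition complement (M : structure L) (X : M) : M :=
  epsilon (carrier_inhabited M) (is_complement X).

Lemma holds_A_c (M : structure L) :
  holds M A_c <-> forall X : M, exists! Y : M, is_complement X Y.
Proof.
split.
- intros h X. destruct (carrier_inhabited M) as [m].
  destruct (h (fun _ => m) X) as [Y [h1 h2]]; simpl in h1, h2.
  exists Y; split.
  + intro a. exact (h1 a).
  + intros Z hZ. symmetry. apply h2. intro a. exact (hZ a).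
- intros h e X. destruct (h X) as [Y [h1 h2]].
  exists Y; split.
  + intro a. exact (h1 a).
  + intros Z hZ. symmetry. apply h2. intro a. exact (hZ a).
Qed.

Lemma complementP (M : structure L) :
  holds M A_c -> forall X : M, unique (is_complement X) (complement X).
Proof.
intros h X. destruct (proj1 (holds_A_c M) h X) as [Y [hY uY]].
assert (hc : is_complement X (complement X)).
{ unfold complement. apply epsilon_spec. exists Y. exact hY. }
split; [exact hc|].
intros Z hZ. rewrite <- (uY _ hc). exact (uY _ hZ).
Qed.

Definition dual_structure (M : structure L) : structure Ld := {|
  carrier := M;
  carrier_inhabited := carrier_inhabited M;
  interp := fun (s : Ld) (A B : M) =>
    match s with sym_S => interp sym_R (complement A) (complement B) end
|}.

(* Main.v *)
(** Renaming relation symbols preserves derivations, and R ↦ S has an inverse,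
    which gives (1). For (2), classical logic makes complementation symmetric,
    so by uniqueness of complements it is an involution: it is its own inverse,
    and A^d S B^d unfolds to A^dd R B^dd, that is, to A R B. *)

From Stdlib Require Import List Classical.
Require Import Defs.

Lemma map_symbols_rename B C (s : B -> C) (r : nat -> nat) (p : formula B) :
  map_symbols s (rename r p) = rename r (map_symbols s p).
Proof. revert r; induction p; intro r; simpl; congruence. Qed.

Lemma map_symbols_shift B C (s : B -> C) (H : list (formula B)) :
  map (map_symbols s) (map (@shift B) H) =
  map (@shift C) (map (map_symbols s) H).
Proof.
rewrite !map_map. apply map_ext. intro p. apply map_symbols_rename.
Qed.

Lemma map_symbols_cancel B C (s : B -> C) (t : C -> B) :
  (forall r, t (s r) = r) ->
  forall p : formula B, map_symbols t (map_symbols s p) = p.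
Proof. intros ts p; induction p; simpl; congruence. Qed.

(** No rule of the calculus mentions a particular relation symbol, so each step translates to an
    instance of the same rule. For the quantifier and equality rules this rests on translation
    commuting with [rename], to which [inst] and [shift] unfold. *)
Lemma derives_map_symbols B C (s : B -> C) (H : list (formula B)) (p : formula B) :
  derives H p -> derives (map (map_symbols s) H) (map_symbols s p).
Proof.
induction 1; simpl in *; unfold inst, shift in *;
  rewrite ?map_symbols_rename, ?map_symbols_shift in *.
- apply d_hyp. now apply in_map.
- now apply d_raa.
- now apply d_impI.
- eapply d_impE; eassumption.
- now apply d_andI.
- eapply d_andE1; eassumption.
- eapply d_andE2; eassumption.
- now apply d_orI1.
- now apply d_orI2.
- eapply d_orE; eassumption.
- now apply d_allI.
- now apply d_allE.
- eapply d_exI; eassumption.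
- eapply d_exE; eassumption.
- apply d_eqI.
- eapply d_eqE; eassumption.
Qed.

(** The target theory is kept arbitrary so that the lemma serves both directions of (1). *)
Lemma provable_map_symbols B C (s : B -> C) (T : formula B -> Prop)
    (T' : formula C -> Prop) (p : formula B) :
  (forall q, T q -> T' (map_symbols s q)) ->
  provable T p -> provable T' (map_symbols s p).
Proof.
intros hT [H [hH d]]. exists (map (map_symbols s) H); split.
- intros q hq. apply in_map_iff in hq. destruct hq as [q' [<- hq']]. auto.
- now apply derives_map_symbols.
Qed.

Definition S_to_R (r : Ld) : L := match r with sym_S => sym_R end.

Lemma dual_formulaK (p : formula L) : map_symbols S_to_R (dual_formula p) = p.
Proof. apply map_symbols_cancel. now intros []. Qed.

Lemma complement_involutive (M : structure L) :
  holds M A_c -> forall X : M, complement (complement X) = X.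
Proof.
intros h X. apply (proj2 (complementP h (complement X))).
(* It remains to see that X is a complement of its own complement; the passage from [~ P] to [Q],
   given [P <-> ~ Q], is classical. *)
intro a. generalize (proj1 (complementP h X) a). tauto.
Qed.

Theorem theorem2p1 (Gamma : formula L -> Prop) (Phi : formula L)
    (hGamma : theory Gamma) (hAc : Gamma A_c) (hPhi : sentence Phi) :
  (provable Gamma Phi <-> provable (dual_theory Gamma) (dual_formula Phi))
  /\
  (forall M : structure L, model M Gamma ->
     isomorphism R_to_S (M := M) (N := dual_structure M) (@complement M)).
Proof.
split.
- split.
  + apply provable_map_symbols. intros q hq. now exists q.
  (* Introducing [d] first shields it from the rewrite, so only the goal presents [Phi] as a
     translation along [S_to_R]. *)
  + intro d. rewrite <- (dual_formulaK Phi). revert d.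
    apply provable_map_symbols. intros q [p [hp ->]].
    now rewrite dual_formulaK.
- intros M hM. pose proof (complement_involutive M (hM _ hAc)) as inv. split.
  + exists (@complement M). split; exact inv.
  + intros [] a b. simpl. now rewrite !inv.
Qed.
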